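(* Let $\mathcal{M}=(S,r)$ be a loop-free finitary matroid and $\kappa$ an infinite cardinal. Then the following are equivalent: (1) $Chr(\mathcal{M})\le\kappa$; (2) $List(\mathcal{M})\le\kappa$; (3) there is a well-ordered base $(B,\le)$ of $\mathcal{M}$ such that for every $b\in B$, $|\{x\in S : M_B(x)=b\}|\le\kappa$.
   Context: A finitary matroid is a pair $\mathcal{M}=(S,r)$, where $S$ is a set and $r:[S]^{<\omega}\to\omega$ is defined on the finite subsets of $S$ and satisfies: $r(\emptyset)=0$; $A\subseteq B$ implies $r(A)\le r(B)$; $r(A)\le |A|$; and $r(A)+r(B)\ge r(A\cap B)+r(A\cup B)$ for all finite $A,B\subseteq S$. A set $X\subseteq S$ is independent if $r(A)=|A|$ for every finite $A\subseteq X$; a circuit is a minimal non-independent subset; a base is a maximal independent set. $\mathcal{M}$ is loop-free if $r(\{x\})=1$ for all $x\in S$. If $B$ is a base and $x\in S\setminus B$, there is a unique circuit contained in $B\cup\{x\}$, called the main circle $C(B,x)$. A well-ordered base is a pair $(B,\le)$ with $B$ a base and $\le$ a well-order on $B$; for it define $M_B:S\to B$ by $M_B(x)=x$ if $x\in B$ and $M_B(x)=\max_{\le}(C(B,x)\cap B)$ if $x\notin B$. A proper coloring of $\mathcal{M}$ by a color set $K$ is a map $\Phi:S\to K$ with every $\Phi^{-1}(i)$ independent. $Chr(\mathcal{M})$ is the least cardinal $\kappa$ such that a proper coloring $S\to\kappa$ exists. A $\kappa$-listing is a function $L$ on $S$ with $|L(x)|\ge\kappa$ for all $x$; an $L$-coloring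 is a proper coloring $\Phi$ with $\Phi(x)\in L(x)$ for all $x$; $List(\mathcal{M})$ is the least cardinal $\kappa$ such that an $L$-coloring exists for every $\kappa$-listing $L$. *)

(* Defs.v *)
From HB Require Import structures.
From mathcomp Require Import all_boot finmap.
From mathcomp Require Import all_classical wochoice.
Set Implicit Arguments.
Unset Strict Implicit.
Unset Printing Implicit Defensive.

Local Open Scope classical_set_scope.
Local Open Scope card_scope.

(* The ground set is the whole type S. Requiring a choiceType, which is needed
   for {fset S}, is no restriction: classically every type is one. *)
Record finitary_matroid (S : choiceType) := FinitaryMatroid {
  rank :> {fset S} -> nat ;
  rank0 : rank fset0 = 0 ;
  rank_mono : forall A B : {fset S}, (A `<=` B)%fset -> rank A <= rank B ;
  rank_card : forall A : {fset S}, rank A <= #|` A| ;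
  rank_submod : forall A B : {fset S},
    rank (A `&` B)%fset + rank (A `|` B)%fset <= rank A + rank B }.

Section Matroid.
Variables (S : choiceType) (M : finitary_matroid S).

Definition loop_free := forall x : S, M [fset x]%fset = 1.

Definition independent (X : set S) :=
  forall A : {fset S}, [set` A] `<=` X -> M A = #|` A|.

Definition circuit (C : set S) :=
  ~ independent C /\ forall D : set S, D `<=` C -> ~ independent D -> D = C.

Definition base (B : set S) :=
  independent B /\ forall X : set S, independent X -> B `<=` X -> X = B.

(* Only the restriction of le to B is constrained. *)
Definition well_ordered_base (B : set S) (le : rel S) :=
  base B /\ wo_chain le (mem B).

(* The default value set0 is relevant only if no such circuit exists, which
   cannot happen when B is a base and x is not in B. *)
Definition main_circle (B : set S) (x : S) : set S :=
  xget set0 [set C | circuit C /\ C `<=` x |` B].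

(* M_B, with values viewed in S. The default value x of xget is relevant only
   if main_circle B x `&` B has no maximum; in a loop-free matroid that set is
   finite and nonempty for every base B and every x outside B. *)
Definition main_max (B : set S) (le : rel S) (x : S) : S :=
  if x \in B then x
  else xget x [set m | maximum_of le (mem (main_circle B x `&` B)) m].

Definition proper_coloring (K : Type) (Phi : S -> K) :=
  forall i : K, independent (Phi @^-1` [set i]).

Definition colorable (K : Type) := exists Phi : S -> K, proper_coloring Phi.

(* The colors of a listing may come from an arbitrary type C. *)
Definition listing (K C : Type) (L : S -> set C) :=
  forall x : S, [set: K] #<= L x.

Definition list_coloring (C : Type) (L : S -> set C) (Phi : S -> C) :=
  proper_coloring Phi /\ forall x : S, L x (Phi x).

Definition list_colorable (K : Type) :=
  forall (C : Type) (L : S -> set C), listing K L ->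
    exists Phi : S -> C, list_coloring L Phi.

End Matroid.

(* A cardinal is represented by any type having that cardinality. *)
Definition is_least_cardinal (P : Type -> Prop) (K : Type) :=
  P K /\ forall K' : Type, P K' -> [set: K] #<= [set: K'].

Definition is_Chr (S : choiceType) (M : finitary_matroid S) (K : Type) :=
  is_least_cardinal (colorable M) K.

Definition is_List (S : choiceType) (M : finitary_matroid S) (K : Type) :=
  is_least_cardinal (list_colorable M) K.

Definition Chr_le (S : choiceType) (M : finitary_matroid S) (K : Type) :=
  exists2 K0 : Type, is_Chr M K0 & [set: K0] #<= [set: K].

Definition List_le (S : choiceType) (M : finitary_matroid S) (K : Type) :=
  exists2 K0 : Type, is_List M K0 & [set: K0] #<= [set: K].

(* Main.v *)
(* For (1) => (3), extend each color class to a base B_i. A set closed under all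
   finite B_i-supports is automatically a flat, and the closure of a point has at
   most K elements. Well-order the ground set so that the points entering at the
   same stage of an exhaustion by such closures are consecutive; then any B_i
   works, since x and M_B(x) always enter at the same stage.
   For (3) => (2), choose colors greedily so that they are distinct on each fiber
   of M_B; then M_B is injective on every color class, and this forces
   independence. *)
From Stdlib Require Inverse_Image.
Require Import Defs.
From mathcomp Require Import all_boot finmap.
From mathcomp Require Import all_classical wochoice.
From mathcomp Require Import zify.
Set Implicit Arguments.
Unset Strict Implicit.
Unset Printing Implicit Defensive.
Local Open Scope classical_set_scope.
Local Open Scope card_scope.

(** * Cardinals *)

Lemma Zorn_maximal_set (T : Type) (P : set (set T)) :
  (forall F : set (set T), F `<=` P -> total_on F subset ->
     P (\bigcup_(X in F) X)) ->
  exists2 A, P A & forall B, P B -> A `<=` B -> B = A.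
Proof.
move=> /Zorn_bigcup[A [PA maxA]]; exists A => // B PB AB.
apply/seteqP; split=> //; apply: contrapT => nBA.
by apply: (maxA B) PB; split.
Qed.

Lemma card_le_funP (T U : Type) (A : set T) (B : set U) (u : U) : A #<= B ->
  exists2 f : T -> U, forall x, A x -> B (f x) &
    forall x y, A x -> A y -> f x = f y -> x = y.
Proof.
case/card_leP=> f.
pose g x := if pselect (A x) is left Ax then val (f (SigSub (mem_set Ax))) else u.
exists g => [x Ax|x y Ax Ay]; rewrite /g.
  by case: pselect => // Ax'; apply: set_mem; exact: valP.
case: pselect => // Ax'; case: pselect => // Ay' /val_inj.
by move/(@inj _ _ _ f) => h; have := h (in_setT _) (in_setT _) => -[].
Qed.

Lemma card_le_setTP (T U : Type) : [set: T] #<= [set: U] ->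
  exists f : T -> U, injective f.
Proof.
case/card_leP=> f.
exists (fun x => val (f (SigSub (mem_set (I : [set: T] x))))) => x y /val_inj.
by move/(@inj _ _ _ f) => h; have := h (in_setT _) (in_setT _) => -[].
Qed.

Lemma card_le_fun (T U : Type) (A : set T) (B : set U) (f : T -> U) :
  (forall x, A x -> B (f x)) ->
  (forall x y, A x -> A y -> f x = f y -> x = y) -> A #<= B.
Proof.
move=> fAB finj.
have fi : {in A &, injective f} by move=> x y /set_mem Ax /set_mem Ay; apply: finj.
rewrite -(card_le_eql (inj_card_eq fi)); apply: subset_card_le.
by move=> _ [x Ax <-]; apply: fAB.
Qed.

(* A maximal set of pairwise everywhere-distinct choice functions exhausts one
   of the sets; evaluating it elsewhere gives the injections. *)
Lemma card_le_min (I T : Type) (i0 : I) (A : I -> set T) :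
  exists i, forall j, A i #<= A j.
Proof.
pose P (X : set (I -> T)) := (forall f, X f -> forall i, A i (f i)) /\
  forall f g, X f -> X g -> forall i, f i = g i -> f = g.
have [F FP totF|X [XA Xinj] Xmax] := @Zorn_maximal_set _ P.
  split=> [f [X /FP[XA _] Xf] i|f g [X FX Xf] [Y FY Yg] i]; first exact: XA.
  have [XY|YX] := totF _ _ FX FY.
    by have [_] := FP _ FY; apply=> //; apply: XY.
  by have [_] := FP _ FX; apply=> //; apply: YX.
have [[i iP]|nP] := pselect (exists i, forall a, A i a -> exists2 f, X f & f i = a).
  exists i => j.
  have [[a0 _]|nA] := pselect (exists a, A i a); last first.
    suff -> : A i = set0 by exact: card_ge0.
    by rewrite -subset0 => a Aa; apply: nA; exists a.
  have /choice[h hP] : forall a, exists f, A i a -> X f /\ f i = a.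
    move=> a; have [/iP[f Xf fa]|na] := pselect (A i a); first by exists f.
    by exists (fun=> a0).
  apply: (@card_le_fun _ _ _ _ (fun a => h a j)) => [a /hP[/XA//]|a b Aa Ab hab].
  have [Xa <-] := hP _ Aa; have [Xb <-] := hP _ Ab.
  by rewrite (Xinj _ _ Xa Xb _ hab).
(* If no [A i] is exhausted, a choice [g] of missed values differs everywhere from every member of
   [X] and contradicts maximality. *)
have /choice[g gP] : forall i, exists a, A i a /\ forall f, X f -> f i <> a.
  move=> i; apply: contrapT => ni; apply: nP; exists i => a Aa.
  apply: contrapT => na; apply: ni; exists a; split=> // f Xf fa.
  by apply: na; exists f.
have PXg : P (X `|` [set g]).
  split=> [f [/XA//|-> i]|f f' [Xf|->] [Xf'|->] i //]; first by have [] := gP i.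
  - exact: Xinj.
  - by have [_ /(_ f Xf)] := gP i.
  - by have [_ /(_ f' Xf')] := gP i => nf /esym.
have /(_ _)/esym E := Xmax _ PXg.
have Xg : X g by rewrite E; [right|move=> f; left].
by have [_ /(_ g Xg)] := gP i0.
Qed.

(** Comparability of cardinals: inside the sum type both sets belong to one family indexed by
    [bool], and [card_le_min] selects its smaller member. *)
Lemma card_le_total (T U : Type) (A : set T) (B : set U) : A #<= B \/ B #<= A.
Proof.
pose F (b : bool) : set (T + U) := if b then inl @` A else inr @` B.
have Ai : (@inl T U) @` A #= A by apply: inj_card_eq => x y _ _ [].
have Bi : (@inr T U) @` B #= B by apply: inj_card_eq => x y _ _ [].
have [[] /= H] := @card_le_min bool _ true F; [left|right].
  by rewrite -(card_le_eql Ai) -(card_le_eqr Bi); exact: (H false).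
by rewrite -(card_le_eqr Ai) -(card_le_eql Bi); exact: (H true).
Qed.

(* [G] is the graph of an injection [X * X -> X] for some [X : set T]. *)
Definition square_graph (T : Type) (G : set (T * T * T)) :=
  let D := [set x | exists z, G (x, x, z)] in
  [/\ forall p z z', G (p, z) -> G (p, z') -> z = z',
      forall p p' z, G (p, z) -> G (p', z) -> p = p',
      forall x y z, G (x, y, z) -> [/\ D x, D y & D z] &
      forall x y, D x -> D y -> exists z, G (x, y, z)].

Lemma square_graph_bigcup (T : Type) (F : set (set (T * T * T))) :
  F `<=` @square_graph T -> total_on F subset ->
  square_graph (\bigcup_(G in F) G).
Proof.
move=> FP totF.
have ub G G' : F G -> F G' -> exists2 H, F H & G `<=` H /\ G' `<=` H.
  by move=> FG FG'; have [GG'|GG'] := totF _ _ FG FG'; [exists G'|exists G] => //; split=> // t.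
split=> [p z z' [G FG Gz] [G' FG' Gz']|p p' z [G FG Gz] [G' FG' Gz']|x y z [G FG Gz]|
  x y [z [G FG Gz]] [z' [G' FG' Gz']]].
- have [H FH [GH GH']] := ub _ _ FG FG'; have [fH _ _ _] := FP _ FH.
  by apply: fH (GH _ Gz) (GH' _ Gz').
- have [H FH [GH GH']] := ub _ _ FG FG'; have [_ fH _ _] := FP _ FH.
  by apply: fH (GH _ Gz) (GH' _ Gz').
- have [_ _ fG _] := FP _ FG.
  by have [[u Gu] [v Gv] [w Gw]] := fG _ _ _ Gz; split; [exists u|exists v|exists w]; exists G.
- have [H FH [GH GH']] := ub _ _ FG FG'; have [_ _ _ fH] := FP _ FH.
  have [||w Hw] := fH x y; [by exists z; apply: GH|by exists z'; apply: GH'|].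
  by exists w, H.
Qed.

(** As the complement of [D] is large enough, [j] puts a disjoint copy of [D] there, and the pairing
    grows to the union [X] of [D] and its copy. *)
Lemma square_graph_extend (T : Type) (G : set (T * T * T))
    (D := [set x | exists z, G (x, x, z)]) (a b : T) :
  square_graph G -> D a -> D b -> a <> b -> D #<= ~` D ->
  exists G', [/\ square_graph G', G `<=` G' & ~ (G' `<=` G)].
Proof.
move=> [Gfun Ginj Gdom Gtot] Da Db nab /(@card_le_funP _ _ _ _ a)[j jD jinj].
have /choice[p pP] : forall u : T * T, exists z, D u.1 -> D u.2 -> G (u, z).
  move=> [x y]; have [[Dx Dy]|nD] := pselect (D x /\ D y).
    by have [z Gz] := Gtot _ _ Dx Dy; exists z.
  by exists x => /= Dx Dy; case: nD.
have pD x y : D x -> D y -> D (p (x, y)).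
  by move=> Dx Dy; have [] := Gdom _ _ _ (pP (x, y) Dx Dy).
have pinj x y x' y' : D x -> D y -> D x' -> D y' -> p (x, y) = p (x', y') ->
    x = x' /\ y = y'.
  move=> Dx Dy Dx' Dy' e; have := pP (x', y') Dx' Dy'; rewrite -e => /Ginj.
  by move=> /(_ _ (pP (x, y) Dx Dy))[].
pose X := D `|` j @` D.
(* [e] folds [X] back into [D]: pairing with [a] marks the points of [D], and pairing with [b] marks
   their copies. *)
have /choice[e eP] : forall u, exists v, (D u -> v = p (u, a)) /\
    forall w, D w -> u = j w -> v = p (w, b).
  move=> u; have [Du|nDu] := pselect (D u).
    by exists (p (u, a)); split=> // w /jD + uw; rewrite -uw.
  have [[w Dw ->]|nj] := pselect (exists2 w, D w & u = j w).
    exists (p (w, b)); split=> [/(jD _ Dw)//|w' Dw' /jinj-> //].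
  by exists u; split=> // w Dw uw; case: nj; exists w.
have eD u : X u -> D (e u).
  move=> [Du|[w Dw <-]].
    by rewrite (eP u).1 //; exact: pD.
  by rewrite ((eP (j w)).2 w) //; exact: pD.
have einj u v : X u -> X v -> e u = e v -> u = v.
  move=> [Du|[w Dw <-]] [Dv|[w' Dw' <-]].
  - by rewrite (eP u).1 // (eP v).1 // => /pinj[].
  - by rewrite (eP u).1 // ((eP (j w')).2 w') // => /pinj[].
  - by rewrite (eP v).1 // ((eP (j w)).2 w) // => /pinj[//|//|//|//|_ /esym].
  - by rewrite ((eP (j w')).2 w') // ((eP (j w)).2 w) // => /pinj[//|//|//|//|->].
(* New pairs take values in the copy of [D], so they never collide with values of [G]. *)
pose N : set (T * T * T) := [set t | let: (u, v, z) := t in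
  [/\ X u, X v, ~ (D u /\ D v) & z = j (p (e u, e v))]].
pose G' := G `|` N.
have D'X x : (exists z, G' (x, x, z)) <-> X x.
  split=> [[z [Gz|[]//]]|Xx]; first by left; exists z.
  have [[z Gz]|nDx] := pselect (D x); first by exists z; left.
  by exists (j (p (e x, e x))); right; split=> // -[].
exists G'; split.
- split.
  + move=> [u v] z z' [Gz|[Xu Xv nuv ->]] [Gz'|[Xu' Xv' nuv' ->//]].
    * exact: Gfun Gz Gz'.
    * by case: nuv'; have [] := Gdom _ _ _ Gz.
    * by case: nuv; have [] := Gdom _ _ _ Gz'.
  + move=> [u v] [u' v'] z [Gz|[Xu Xv nuv ->]] [Gz'|[Xu' Xv' nuv' E]].
    * exact: Ginj Gz Gz'.
    * have [_ _] := Gdom _ _ _ Gz; rewrite E; move=> Dz; case: (jD _ _ Dz).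
      by apply: pD; apply: eD.
    * have [_ _] := Gdom _ _ _ Gz'; move=> Dz; case: (jD _ _ Dz).
      by apply: pD; apply: eD.
    * have /pinj[] : p (e u, e v) = p (e u', e v').
        by apply: jinj E; apply: pD; apply: eD.
      1-4: exact: eD.
      by move=> /(einj _ _ Xu Xu')-> /(einj _ _ Xv Xv')->.
  + move=> x y z [Gz|[Xx Xy _ ->]].
      by have [Dx Dy Dz] := Gdom _ _ _ Gz; split; apply/D'X; left.
    split; apply/D'X => //; right; exists (p (e x, e y)) => //.
    by apply: pD; apply: eD.
  + move=> x y /D'X Xx /D'X Xy.
    have [[Dx Dy]|nD] := pselect (D x /\ D y).
      by have [z Gz] := Gtot _ _ Dx Dy; exists z; left.
    by exists (j (p (e x, e y))); right.
- by move=> t; left.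
- move=> sub; suff [z Gz] : D (j a) by case: (jD a Da); exists z.
  have /D'X[z /sub Gz] : X (j a) by right; exists a.
  by exists z.
Qed.

(** Zorn's lemma on partial pairings: for a maximal one with domain [D], the complement of [D]
    cannot be as large as [D], so [K] is no larger than two copies of [D], hence than [D], and
    inherits its pairing. *)
Lemma card_square_le (K : Type) : infinite_set [set: K] ->
  [set: K * K] #<= [set: K].
Proof.
move=> /infiniteP infK.
have [k _] : [set: K] !=set0.
  apply/set0P; apply/eqP => E; move: infK; rewrite E => /card_le0P.
  by move=> /seteqP[/(_ 0%N I)].
have [e _ einj] := card_le_funP k infK.
pose P (G : set (K * K * K)) := square_graph G /\ (G = set0 \/
  exists x y z z', [/\ x <> y, G (x, x, z) & G (y, y, z')]).
have [F FP totF|G [sG Gbig] Gmax] := @Zorn_maximal_set _ P.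
  split; first by apply: square_graph_bigcup => // G /FP[].
  have [all0|] := pselect (forall G, F G -> G = set0).
    by left; rewrite -subset0 => t [G /all0->].
  move=> /existsNP[G /not_implyP[FG G0]]; right.
  have [_ [//|[x [y [z [z' [nxy Gx Gy]]]]]]] := FP _ FG.
  by exists x, y, z, z'; split=> //; exists G.
have {Gbig} [G0|[a [b [za [zb [nab Ga Gb]]]]]] := Gbig.
  have [q _ qinj] := card_le_funP 0%N ((card_eqPle _ _).1 card_nat2).1.
  (* A pairing of the naturals carried over by [e] is a nonempty member of [P], so [set0] is not
     maximal. *)
  pose H : set (K * K * K) :=
    [set t | exists m n, t = (e m, e n, e (q (m, n)))].
  have He m n : e m = e n -> m = n by apply: einj.
  have HD m : exists z, H (e m, e m, z) by exists (e (q (m, m))), m, m.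
  have PH : P H.
    split; last first.
      right; exists (e 0%N), (e 1%N), (e (q (0, 0)%N)), (e (q (1, 1)%N)).
      by split; [move=> /He|exists 0%N, 0%N|exists 1%N, 1%N].
    split.
    - move=> _ z z' [m [n [-> ->]]] [m' [n' [/He-> /He-> ->]]] //.
    - move=> _ p' z [m [n [-> ->]]] [m' [n' [-> /He/qinj E]]].
      by case: (E Logic.I Logic.I) => -> ->.
    - move=> _ _ _ [m [n [-> -> ->]]]; split; exact: HD.
    - move=> x y [_ [m [_ [-> _ _]]]] [_ [n [_ [-> _ _]]]].
      by exists (e (q (m, n))), m, n.
  have E : H = G by apply: Gmax => //; rewrite G0.
  suff : G (e 0%N, e 0%N, e (q (0, 0)%N)) by rewrite G0.
  by rewrite -E; exists 0%N, 0%N.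
pose D := [set x | exists z, G (x, x, z)].
have Da : D a by exists za.
have Db : D b by exists zb.
have [le|le] := card_le_total D (~` D).
  have [G' [sG' GG' nG']] := square_graph_extend sG Da Db nab le.
  have PG' : P G'.
    by split=> //; right; exists a, b, za, zb; split=> //; exact: GG'.
  by case: nG'; rewrite (Gmax _ PG' GG').
have DD : D `*` D #<= D.
  have [Gfun Ginj Gdom Gtot] := sG.
  have /choice[p pP] : forall u : K * K, exists z, D u.1 -> D u.2 -> G (u, z).
    move=> [x y]; have [[Dx Dy]|nD] := pselect (D x /\ D y).
      by have [z Gz] := Gtot _ _ Dx Dy; exists z.
    by exists x => /= Dx Dy; case: nD.
  apply: (@card_le_fun _ _ _ _ p) => [[x y] [/= Dx Dy]|u v [Du Du'] [Dv Dv'] E].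
    by have [] := Gdom _ _ _ (pP (x, y) Dx Dy).
  by apply: Ginj (pP u Du Du') _; rewrite E; apply: pP.
have KDD : [set: K] #<= D `*` D.
  have [f fD finj] := card_le_funP a le.
  apply: (@card_le_fun _ _ _ _ (fun x => if pselect (D x) then (x, a) else (f x, b))).
    by move=> x _; case: pselect => Dx; split=> //=; apply: fD.
  move=> x y _ _; case: pselect => Dx; case: pselect => Dy // [].
  - by move=> ->.
  - by move=> _ /nab.
  - by move=> _ /esym/nab.
  - exact: finj.
have KD := card_le_trans KDD DD.
apply: card_le_trans (card_leT D); apply: card_le_trans DD.
have [g gD ginj] := card_le_funP a KD.
apply: (@card_le_fun _ _ _ _ (fun u => (g u.1, g u.2))) => [[x y] _|[x y] [x' y'] _ _ /= []].
  by split; apply: gD.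
by move=> /ginj-> // /ginj->.
Qed.

(** A sequence is coded by iterated pairing of its entries together with its length, because
    sequences of different lengths could share the folded code. *)
Lemma card_seq_le (K : Type) : infinite_set [set: K] ->
  [set: seq K] #<= [set: K].
Proof.
move=> infK; have [k _] := infinite_setN0 infK.
have [p _ pinj] := card_le_funP k (card_square_le infK).
have /infiniteP/(card_le_funP k)[e _ einj] := infK.
pose c := foldr (fun x y => p (x, y)) k.
have pE x y x' y' : p (x, y) = p (x', y') -> x = x' /\ y = y'.
  by move=> /pinj E; have [] := E Logic.I Logic.I.
apply: (@card_le_fun _ _ _ _ (fun s => p (e (size s), c s))) => // s t _ _.
move=> /pE[est]; have {est} : size s = size t by apply: einj.
by elim: s t => [|x s IH] [|y t] //= [/IH{}IH] /pE[-> /IH ->].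
Qed.

(** * Well-orders *)

(** Read off from the least element of the set of the three points. *)
Lemma wo_chain_transitive (T : eqType) (R : rel T) (C : {pred T}) :
  wo_chain R C -> {in C & &, transitive R}.
Proof.
move=> Rwo y x z Cy Cx Cz Rxy Ryz.
have Ranti := wo_chain_antisymmetric Rwo.
have [||w [[]]] := Rwo (mem [:: x; y; z]).
- by move=> t; rewrite !inE => /or3P[]/eqP->.
- by exists x; rewrite mem_head.
rewrite !inE => /or3P[]/eqP-> lb _.
- by apply: lb; rewrite !inE eqxx !orbT.
- suff -> : x = y by [].
  by apply: Ranti => //; rewrite Rxy lb // mem_head.
- suff <- : y = z by [].
  by apply: Ranti => //; rewrite Ryz lb // !inE eqxx !orbT.
Qed.

Lemma wo_chain_maximum (T : eqType) (R : rel T) (C : {pred T}) (s : seq T) :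
  wo_chain R C -> {subset s <= C} -> s <> [::] ->
  exists2 m, m \in s & {in s, forall x, R x m}.
Proof.
move=> Rwo; have Rtr := wo_chain_transitive Rwo.
have Rxx := wo_chain_reflexive Rwo; have Rtot := wo_chainW Rwo.
elim: s => // x [|y s] IH sC _.
  by exists x; rewrite ?mem_head // => t /[!inE]/eqP->; apply/Rxx/sC/mem_head.
have [||m ms mub] := IH; [by move=> t ts; apply: sC; rewrite inE ts orbT|by []|].
have Cx : x \in C by apply/sC/mem_head.
have Cm : m \in C by apply: sC; rewrite inE ms orbT.
have /orP[xm|mx] := Rtot _ _ Cx Cm.
  by exists m; [rewrite inE ms orbT|move=> t; rewrite inE => /orP[/eqP->|/mub]].
exists x; first exact: mem_head.
move=> t; rewrite inE => /orP[/eqP->|ts]; first exact: Rxx.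
by apply: (Rtr m) => //; [apply: sC; rewrite inE ts orbT|exact: mub].
Qed.

Lemma wf_minimum (T : Type) (lt : T -> T -> Prop) (P : set T) :
  well_founded lt -> P !=set0 ->
  exists2 x, P x & forall y, P y -> ~ lt y x.
Proof.
move=> wf [x0]; elim/(well_founded_ind wf): x0 => x IH Px.
have [[y Py yx]|nx] := pselect (exists2 y, P y & lt y x); first exact: IH yx Py.
by exists x => // y Py yx; apply: nx; exists y.
Qed.

Record strict_wo (T : Type) (lt : T -> T -> Prop) := StrictWo {
  swo_wf : well_founded lt ;
  swo_irr : forall x, ~ lt x x ;
  swo_trans : forall x y z, lt x y -> lt y z -> lt x z ;
  swo_total : forall x y, x <> y -> lt x y \/ lt y x }.

Lemma strict_wo_exists (T : choiceType) : exists lt : T -> T -> Prop, strict_wo lt.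
Proof.
have [R Rwo] := well_ordering_principle T.
have Rch : wo_chain R predT by apply: withinW.
have Rtot x y : R x y || R y x by apply: (wo_chainW Rch).
have Rtr x y z : R x y -> R y z -> R x z by apply: (wo_chain_transitive Rch).
have Ran x y : R x y -> R y x -> x = y.
  by move=> xy yx; apply: (wo_chain_antisymmetric Rch) => //; rewrite xy.
exists (fun x y => R x y /\ x <> y); split.
- move=> x; apply: contrapT => nx.
  have [|m [[mA mlb] _]] := Rwo [pred x | `[< ~ Acc (fun x y => R x y /\ x <> y) x >]].
    by exists x; apply/asboolP.
  move: mA => /asboolP; apply; constructor => y [ym nym].
  apply: contrapT => ny; apply: nym; apply: Ran => //; apply: mlb.
  exact/asboolP.
- by move=> x [].
- move=> x y z [xy nxy] [yz nyz]; split; first exact: Rtr yz.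
  by move=> xz; apply: nxy; apply: Ran => //; rewrite xz.
- by move=> x y nxy; have /orP[] := Rtot x y => ?; [left|right]; split=> // /esym.
Qed.

(** Plays the role of an initial ordinal: if some segment is as large as [K], then [F] injects into
    the segment below the least such point, and the order pulled back along this injection has small
    segments. *)
Lemma initial_wo (T : choiceType) (K : Type) (F : set T) (k : K) : F #<= [set: K] ->
  exists lt : T -> T -> Prop, [/\ well_founded lt,
    forall x y, F x -> F y -> x <> y -> lt x y \/ lt y x &
    forall x, F x -> ~ ([set: K] #<= [set y | F y /\ lt y x])].
Proof.
move=> FK; have [lt [wf irr tr tot]] := strict_wo_exists T.
pose Big := [set x | F x /\ [set: K] #<= [set y | F y /\ lt y x]].
have [[x Bx]|nBig] := pselect (Big !=set0); last first.
  exists lt; split=> // [x y _ _|x Fx Kx]; first exact: tot.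
  by apply: nBig; exists x.
have [{Bx}x [Fx Kx] xmin] := wf_minimum wf (ex_intro _ x Bx).
have [j jx jinj] := card_le_funP x (card_le_trans FK Kx).
exists (fun y z => lt (j y) (j z)); split.
- exact: Inverse_Image.wf_inverse_image.
- by move=> y z Fy Fz nyz; apply: tot => /jinj; auto.
- move=> z Fz Kz; have [Fjz jzx] := jx _ Fz.
  apply: (xmin (j z)) jzx; split=> //; apply: card_le_trans Kz _.
  apply: (@card_le_fun _ _ _ _ j) => [y [Fy yz]|y y' [Fy _] [Fy' _]].
    by split=> //; have [] := jx _ Fy.
  exact: jinj.
Qed.

(* Greedy choice along a well-order of [F] all of whose proper initial segments
   are smaller than [K]. *)
Lemma injective_transversal (T : choiceType) (K C : Type) (F : set T)
    (L : T -> set C) (k : K) :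
  F #<= [set: K] -> (forall x, [set: K] #<= L x) ->
  exists2 f : T -> C, forall x, L x (f x) &
    forall x y, F x -> F y -> f x = f y -> x = y.
Proof.
move=> FK KL; have [lt [wf tot small]] := initial_wo k FK.
have L0 x : exists c, L x c.
  apply: contrapT => nc; have : L x = set0.
    by rewrite -subset0 => c Lc; apply: nc; exists c.
  move=> E; have := KL x; by rewrite E => /card_le0P/seteqP[/(_ k Logic.I)].
have step x (rec : forall y, lt y x -> C) :
    exists c, L x c /\ (F x -> forall y (h : lt y x), F y -> rec y h <> c).
  have [Fx|nFx] := pselect (F x); last by have [c Lc] := L0 x; exists c.
  apply: contrapT => nc.
  (* If every color of [L x] were already used, sending a color to an earlier point that uses it
     would inject [L x] into the segment below [x], which is too small. *)
  have /choice[g gP] : forall c, exists y, L x c -> F y /\ exists h, rec y h = c.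
    move=> c; have [Lc|nLc] := pselect (L x c); last by exists x.
    apply: contrapT => ng; apply: nc; exists c; split=> // _ y h Fy rc.
    by apply: ng; exists y => _; split=> //; exists h.
  apply: (small x Fx); apply: card_le_trans (KL x) _.
  apply: (@card_le_fun _ _ _ _ g) => [c /gP[Fy [h _]]//|c c'].
  have recE y y' h h' : y = y' -> rec y h = rec y' h'.
    by move=> E; subst y'; congr rec; apply: Prop_irrelevance.
  by move=> /gP[_ [h hc]] /gP[_ [h' hc']] E; rewrite -hc -hc'; apply: recE.
pose body x rec := projT1 (cid (step x rec)).
pose f := Fix wf (fun=> C) body.
have fE x : f x = body x (fun y _ => f y).
  apply: (Fix_eq wf (fun=> C)) => {}x g h gh; congr body.
  by apply: functional_extensionality_dep => y; apply: functional_extensionality_dep => yx; exact: gh.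
have fP x : L x (f x) /\ (F x -> forall y, lt y x -> F y -> f y <> f x).
  by rewrite [f x]fE /body; case: cid => c [].
exists f => [x|x y Fx Fy fxy]; first by have [] := fP x.
apply: contrapT => nxy; have [xy|yx] := tot _ _ Fx Fy nxy.
  by have [_ /(_ Fy _ xy Fx)] := fP y.
by have [_ /(_ Fx _ yx Fy)] := fP x; rewrite fxy.
Qed.

(** * Spans, circuits and bases *)

Section MatroidTheory.
Variables (S : choiceType) (M : finitary_matroid S).
Implicit Types (A B C X : set S) (D E F : {fset S}) (x y z : S).

(** The closure operator of the matroid, extended to infinite sets through finite witnesses. *)
Definition span A : set S :=
  [set x | exists2 D : {fset S}, [set` D] `<=` A & M (x |` D)%fset = M D].

(** Submodularity for [F] joined with [D] against [E]: their intersection contains [D], so a zero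
    increment of rank over [D] stays zero over [E]. *)
Lemma rank_fsetU_mono D E F : (D `<=` E)%fset -> M (F `|` D)%fset = M D ->
  M (F `|` E)%fset = M E.
Proof.
move=> DE FD; have := rank_submod M (F `|` D)%fset E.
have -> : ((F `|` D) `|` E = F `|` E)%fset.
  by rewrite -fsetUA; congr (_ `|` _)%fset; apply/fsetUidPr.
have : M D <= M ((F `|` D) `&` E)%fset.
  by apply: rank_mono; rewrite fsubsetI DE fsubsetUr.
have : M E <= M (F `|` E)%fset by apply: rank_mono; exact: fsubsetUr.
rewrite FD; lia.
Qed.

Lemma span_mono A B : A `<=` B -> span A `<=` span B.
Proof. by move=> AB x [D DA xD]; exists D => // y /DA/AB. Qed.

Lemma subset_span A : A `<=` span A.
Proof.
move=> x Ax; exists [fset x]%fset; last by rewrite fsetUid.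
by move=> y /=; rewrite inE => /eqP->.
Qed.

Lemma span_fset A D : [set` D] `<=` span A ->
  exists2 E : {fset S}, [set` E] `<=` A & M (D `|` E)%fset = M E.
Proof.
elim/fset1U_rect: D => [_|x D xD IH xDA].
  by exists fset0; rewrite ?fset0U // => y /=; rewrite inE.
have [|E EA DE] := IH; first by move=> y yD; apply: xDA; apply/fset1UP; right.
have [|E' EA' xE'] := xDA x; first by apply/fset1UP; left.
exists (E `|` E')%fset; first by move=> y /=; rewrite inE => /orP[/EA|/EA'].
rewrite -fsetUA (rank_fsetU_mono _ xE'); last by rewrite fsubsetU // fsubsetUr orbT.
by apply: rank_fsetU_mono DE; exact: fsubsetUl.
Qed.

Lemma span_trans A B : A `<=` span B -> span A `<=` span B.
Proof.
move=> AB x [D DA xD]; have [y /DA/AB//|E EB DE] := @span_fset B D.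
exists E => //; apply/eqP; rewrite eqn_leq; apply/andP; split; last exact/rank_mono/fsubsetUr.
rewrite -[leqRHS]DE -(rank_fsetU_mono (fsubsetUl D E) xD) rank_mono //.
by apply: fsetUS; exact: fsubsetUr.
Qed.

Lemma independent_span B x : independent M B -> B x -> ~ span (B `\ x) x.
Proof.
move=> iB Bx [D DB]; have xD : x \notin D by apply/negP => /DB[_]; apply.
rewrite iB; last by move=> y /fset1UP[->//|/DB[]].
rewrite iB; last by move=> y /DB[].
by rewrite cardfsU1 xD; lia.
Qed.

Lemma independent_sub A B : A `<=` B -> independent M B -> independent M A.
Proof. by move=> AB iB D DA; apply: iB => x /DA/AB. Qed.

Lemma independent1 x : loop_free M -> independent M [set x].
Proof.
move=> lf D Dx; have [->|[y yD]] := fset_0Vmem D; first by rewrite rank0 cardfs0.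
have -> : D = [fset x]%fset; last by rewrite lf cardfs1.
apply/fsetP => z; rewrite inE; apply/idP/eqP => [/Dx//|->].
by rewrite -(Dx y yD).
Qed.

Lemma not_independent A : ~ independent M A ->
  exists2 D : {fset S}, [set` D] `<=` A & M D < #|` D|.
Proof.
move=> /existsNP[D /not_implyP[DA MD]]; exists D => //.
by have := rank_card M D; move/eqP: MD; lia.
Qed.

(** A dependent finite subset of [C] is all of [C] by minimality. Deleting a point leaves an
    independent set, whose rank is then already the rank of the circuit. *)
Lemma circuit_fset C : circuit M C ->
  exists2 D : {fset S}, C = [set` D] & forall x, x \in D -> span ([set` D] `\ x) x.
Proof.
move=> [niC Cmin]; have [D DC MD] := not_independent niC.
have DE : [set` D] = C by apply: Cmin => // /(_ D (fun _ h => h)); lia.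
exists D => // x xD; exists (D `\ x)%fset.
  by move=> y; rewrite /= !inE => /andP[/eqP yx yD].
rewrite fsetD1K //; apply/eqP; rewrite eqn_leq; apply/andP; split; last exact/rank_mono/fsubD1set.
have -> : M (D `\ x)%fset = #|` D `\ x|%fset.
  apply: contrapT => MDx; have DxE : [set` (D `\ x)%fset] = C.
    apply: Cmin; first by rewrite -DE => y /=; rewrite !inE => /andP[].
    by move=> /(_ _ (fun _ h => h)).
  have : C x by rewrite -DE.
  by rewrite -DxE /= !inE eqxx.
by move: MD; rewrite (cardfsD1 x D) xD; lia.
Qed.

(** A dependent finite subset of least cardinality is a circuit. *)
Lemma circuit_exists A : ~ independent M A -> exists2 C, circuit M C & C `<=` A.
Proof.
move=> /not_independent[D0 D0A MD0].
pose P n := `[< exists D : {fset S}, [/\ [set` D] `<=` A, M D < #|` D| & #|` D| = n] >].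
have exP : exists n, P n by exists #|` D0|; apply/asboolP; exists D0.
case: (ex_minnP exP) => n /asboolP[D [DA MD Dn]] nmin.
exists [set` D] => //; split=> [/(_ D)|B BD]; first by move=> /(_ (fun _ h => h)); lia.
move=> /not_independent[E EB ME].
have ED : (E `<=` D)%fset by apply/fsubsetP => y /EB/BD.
have nE : n <= #|` E|.
  by apply: nmin; apply/asboolP; exists E; split=> // y /EB/BD/DA.
have EDE : E = D by apply/eqP; rewrite eqEfcard ED Dn.
by apply/seteqP; split=> //; rewrite -EDE.
Qed.

(** Finitely many points of the union of a chain lie in one member; the first alternative accounts
    for the empty chain. *)
Lemma fset_chain_cover (F : set (set S)) (X0 : set S) D : total_on F subset ->
  [set` D] `<=` (\bigcup_(X in F) X) `|` X0 ->
  [set` D] `<=` X0 \/ exists2 X, F X & [set` D] `<=` X `|` X0.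
Proof.
move=> totF; elim/fset1U_rect: D => [_|x D _ IH xDF].
  by left=> x /=; rewrite inE.
have [|DX0|[X FX DX]] := IH; first by move=> y yD; apply: xDF; apply/fset1UP; right.
- have [|[Y FY Yx]|X0x] := xDF x; first by apply/fset1UP; left.
    by right; exists Y => // y /fset1UP[->|/DX0]; [left|right].
  by left=> y /fset1UP[->|/DX0].
- right; have [|[Y FY Yx]|X0x] := xDF x; first by apply/fset1UP; left.
    have [XY|YX] := totF _ _ FX FY.
      by exists Y => // y /fset1UP[->|/DX[/XY|]]; [left|left|right].
    by exists X => // y /fset1UP[->|/DX//]; left; apply: YX.
  by exists X => // y /fset1UP[->|/DX//]; right.
Qed.

Lemma base_extend X : independent M X -> exists2 B, base M B & X `<=` B.
Proof.
move=> iX.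
(* Zorn's lemma concerns the sets [Y] whose union with [X] is independent, rather than supersets of
   [X], because the empty chain has empty union. *)
have [F FP totF|Y iY Ymax] := @Zorn_maximal_set _ [set Y | independent M (Y `|` X)].
  move=> D /(fset_chain_cover totF)[/iX//|[Y FY DY]].
  exact: (FP _ FY).
exists (Y `|` X); last by move=> x; right.
split=> // Z iZ YXZ; have ZX : Z `|` X = Z by apply/setUidPl => x Xx; apply: YXZ; right.
have ZY : Z = Y by apply: Ymax; [rewrite /= ZX|move=> x Yx; apply: YXZ; left].
by rewrite -{1}ZX ZY.
Qed.

Lemma main_circleP B x : base M B -> ~ B x ->
  [/\ circuit M (main_circle M B x), main_circle M B x `<=` x |` B &
      main_circle M B x x].
Proof.
move=> [iB Bmax] nBx.
have [cC Cx] : [set C | circuit M C /\ C `<=` x |` B] (main_circle M B x).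
  apply: xgetPex; have [|C cC CB] := @circuit_exists (x |` B); last by exists C.
  move=> ixB; apply: nBx; rewrite -(Bmax _ ixB); [by left|by move=> y; right].
split=> //; apply: contrapT => nCx; case: cC => + _; apply.
by apply: independent_sub iB => y Cy; have [yx|//] := Cx y Cy; rewrite yx in Cy.
Qed.

(** [s] lists the circuit without [x]. It is nonempty because a circuit consisting of [x] alone
    would be a loop; the last clause is exchange within the circuit. *)
Lemma main_circle_support B x : loop_free M -> base M B -> ~ B x ->
  exists s : seq S, [/\ s <> [::], [set` s] = main_circle M B x `&` B,
    span [set` s] x & forall y, y \in s -> span ((x |` [set` s]) `\ y) y].
Proof.
move=> lf bB nBx; have [cC Cx xC] := main_circleP bB nBx.
have [D CD Dspan] := circuit_fset cC.
have xD : x \in D by move: xC; rewrite CD.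
have sE : [set` (D `\ x)%fset : seq S] = main_circle M B x `&` B.
  apply/seteqP; split=> y /=; rewrite CD.
    rewrite !inE => /andP[/eqP yx yD]; split=> //.
    by have [] := Cx y; rewrite ?CD.
  by move=> [/= yD By]; rewrite !inE yD andbT; apply/eqP => yx; rewrite yx in By.
exists (D `\ x)%fset; split=> //.
- move=> s0; have Dx : (D `<=` [fset x])%fset by rewrite -fsetD_eq0; apply/eqP/val_inj.
  have [+ _] := cC; apply; rewrite CD; apply: (@independent_sub _ [set x]); last exact: independent1.
  by move=> y /(fsubsetP Dx); rewrite inE => /eqP.
- by apply: span_mono (Dspan x xD) => y [/= yD /eqP yx]; rewrite /= !inE yx.
- move=> y; rewrite !inE => /andP[yx yD].
  apply: span_mono (Dspan y yD) => z [/= zD zy]; split=> //.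
  by have [->|zx] := eqVneq z x; [left|right; rewrite /= !inE zx].
Qed.

Lemma main_max_in B le x : B x -> main_max M B le x = x.
Proof. by move=> Bx; rewrite /main_max ifT // inE. Qed.

Lemma main_max_out B le x : loop_free M -> well_ordered_base M B le -> ~ B x ->
  main_circle M B x (main_max M B le x) /\ B (main_max M B le x) /\
  forall b, main_circle M B x b -> B b -> le b (main_max M B le x).
Proof.
move=> lf [bB woB] nBx; rewrite /main_max ifF; last by apply/negbTE/negP => /set_mem.
have [s [s0 sE _ _]] := main_circle_support lf bB nBx.
have [|m ms mub] := wo_chain_maximum woB _ s0.
  by move=> y ys; apply/mem_set; have [] : (main_circle M B x `&` B) y by rewrite -sE.
have : [set m | maximum_of le (mem (main_circle M B x `&` B)) m]
    (xget x [set m | maximum_of le (mem (main_circle M B x `&` B)) m]).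
  apply: xgetPex; exists m; split; first by apply/mem_set; rewrite -sE.
  by move=> y /set_mem; rewrite -sE; exact: mub.
set w := xget _ _ => -[/set_mem[Cw Bw] wub]; split=> //; split=> // b Cb Bb.
by apply: wub; apply/mem_set.
Qed.

End MatroidTheory.

(** * Colorings *)

(** Minimizing over all types reduces to minimizing over subsets of [K]: every type either dominates
    [K] or is equipotent to such a subset. *)
Lemma least_cardinal_exists (P : Type -> Prop) (K : Type) : P K ->
  (forall K1 K2 : Type, [set: K1] #<= [set: K2] -> P K1 -> P K2) ->
  exists2 K0, is_least_cardinal P K0 & [set: K0] #<= [set: K].
Proof.
move=> PK Pmono; pose I := {A : set K | P (set_type A)}.
have cT (A : set K) : [set: set_type A] #<= A /\ A #<= [set: set_type A].
  by have /card_eqPle := card_setT A.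
have PT : P (set_type [set: K]) by apply: Pmono PK; have [] := cT [set: K].
have [[A PA] Amin] := @card_le_min I K (exist _ _ PT) sval.
have AK : [set: set_type A] #<= [set: K].
  by apply: card_le_trans (card_leT A); have [] := cT A.
exists (set_type A) => //; split=> // K' PK'.
have [KK'|K'K] := card_le_total [set: K] [set: K']; first exact: card_le_trans KK'.
have [f finj] := card_le_setTP K'K.
have /card_eqPle[rK Kr] : range f #= [set: K'] by apply: inj_card_eq => x y _ _ /finj.
have Pr : P (set_type (range f)).
  by apply: Pmono PK'; apply: card_le_trans Kr _; have [] := cT (range f).
apply: card_le_trans (cT A).1 _; apply: card_le_trans rK.
exact: (Amin (exist _ _ Pr)).
Qed.

Section Colorings.
Variables (S : choiceType) (M : finitary_matroid S).
Implicit Types (B X : set S) (x y z : S).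

Lemma colorable_mono (K1 K2 : Type) : [set: K1] #<= [set: K2] ->
  colorable M K1 -> colorable M K2.
Proof.
move=> /card_le_setTP[f finj] [Phi PhiP]; exists (f \o Phi) => i D Di.
have [->|[x xD]] := fset_0Vmem D; first by rewrite rank0 cardfs0.
apply: (PhiP (Phi x)) => y yD; apply: finj.
by have /= -> := Di y yD; have /= -> := Di x xD.
Qed.

Lemma list_colorable_mono (K1 K2 : Type) : [set: K1] #<= [set: K2] ->
  list_colorable M K1 -> list_colorable M K2.
Proof.
by move=> K12 lc C L LK; apply: lc => x; apply: card_le_trans K12 (LK x).
Qed.

Lemma Chr_leP (K : Type) : Chr_le M K <-> colorable M K.
Proof.
split=> [[K0 [cK0 _] K0K]|cK]; first exact: colorable_mono cK0.
exact: least_cardinal_exists cK colorable_mono.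
Qed.

Lemma List_leP (K : Type) : List_le M K <-> list_colorable M K.
Proof.
split=> [[K0 [cK0 _] K0K]|cK]; first exact: list_colorable_mono cK0.
exact: least_cardinal_exists cK list_colorable_mono.
Qed.

Lemma list_colorable_colorable (K : Type) : list_colorable M K -> colorable M K.
Proof. by move=> /(_ K (fun=> setT))[x|Phi [PhiP _]]; [|exists Phi]. Qed.

(** * From a well-ordered base to list colorings *)

Lemma main_maxB B le x : loop_free M -> well_ordered_base M B le ->
  B (main_max M B le x).
Proof.
move=> lf woB; have [Bx|nBx] := pselect (B x); first by rewrite main_max_in.
by have [_ []] := main_max_out lf woB nBx.
Qed.

Lemma span_below_main_max B le x : loop_free M -> well_ordered_base M B le ->
  span M [set b | B b /\ le b (main_max M B le x)] x.
Proof.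
move=> lf woB; have [bB wo] := woB.
have [Bx|nBx] := pselect (B x).
  apply: subset_span; split=> //; rewrite main_max_in //.
  by apply: (wo_chain_reflexive wo); apply/mem_set.
have [_ [_ mub]] := main_max_out lf woB nBx.
have [s [_ sE sx _]] := main_circle_support lf bB nBx.
by apply: span_mono sx; rewrite sE => b [Cb Bb]; split=> //; exact: mub.
Qed.

(* The element of a circuit with the largest [main_max] value [m] would put [m]
   into the span of the smaller elements of the base. *)
Lemma main_max_inj_independent B le X : loop_free M -> well_ordered_base M B le ->
  (forall x y, X x -> X y -> main_max M B le x = main_max M B le y -> x = y) ->
  independent M X.
Proof.
move=> lf woB Xinj; have [bB wo] := woB; have [iB _] := bB.
have leB x y : B x -> B y -> le x y -> le y x -> x = y.
  move=> Bx By xy yx.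
  by apply: (wo_chain_antisymmetric wo); rewrite ?xy //; apply/mem_set.
have letr x y z : B x -> B y -> B z -> le x y -> le y z -> le x z.
  by move=> Bx By Bz; apply: (wo_chain_transitive wo); apply/mem_set.
apply: contrapT => niX; have [C cC CX] := circuit_exists niX.
have [D CD Dspan] := circuit_fset cC; set mm := main_max M B le.
have mmB y : B (mm y) by exact: main_maxB.
have [||_ /mapP[x xD ->] xmax] := wo_chain_maximum (s := [seq mm y | y <- D]) wo.
- by move=> _ /mapP[y _ ->]; apply/mem_set.
- have [D0|[y yD]] := fset_0Vmem D; last first.
    by move=> s0; have := map_f mm (yD : y \in enum_fset D); rewrite s0.
  case: cC => + _; case; rewrite CD D0 => E ED; suff -> : E = fset0 by rewrite rank0.
  by apply/fsetP => z; rewrite inE; apply/negP => /ED; rewrite /= inE.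
pose Lm := [set b | [/\ B b, le b (mm x) & b <> mm x]].
(* By injectivity and the choice of [x], the other points of the circuit have smaller [main_max], so
   they lie in the span of [Lm], and [x] with them. *)
have xL : span M Lm x.
  apply: span_trans (Dspan x xD) => y [/= yD yx].
  have yx' : mm y <> mm x by move=> /Xinj e; apply: yx; apply: e; apply: CX; rewrite CD.
  have lyx : le (mm y) (mm x) by apply: xmax; apply: map_f.
  apply: span_mono (span_below_main_max y lf woB) => b [Bb by_].
  split=> //; first exact: letr lyx.
  move=> bx; apply: yx'; apply: leB => //; by rewrite -bx.
apply: (independent_span iB (mmB x)).
apply: (@span_mono _ _ Lm); first by move=> b [Bb _ bx]; split.
have [Bx|nBx] := pselect (B x); first by rewrite [mm x]main_max_in.
have [Cm [_ mub]] := main_max_out lf woB nBx.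
have [s [_ sE _ sy]] := main_circle_support lf bB nBx.
have ms : mm x \in s.
  by have : (main_circle M B x `&` B) (mm x) by []; rewrite -sE.
(* Exchange in the main circle: [mm x] is spanned by [x], which is in the span of [Lm], and by the
   other base points of the circle, which are in [Lm]. *)
apply: span_trans (sy _ ms) => b [[-> //|bs] bm]; apply: subset_span.
have [Cb Bb] : (main_circle M B x `&` B) b by rewrite -sE.
by split=> //; exact: mub.
Qed.

Lemma main_max_list_colorable (K : Type) B le : loop_free M ->
  infinite_set [set: K] -> well_ordered_base M B le ->
  (forall b, B b -> [set x | main_max M B le x = b] #<= [set: K]) ->
  list_colorable M K.
Proof.
move=> lf infK woB small C L LK; have [k _] := infinite_setN0 infK.
(* One greedy choice is made for each fiber; the fibers over points outside [B] are empty. *)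
have /choice[f fP] : forall b : S, exists f : S -> C, (forall x, L x (f x)) /\
    forall x y, main_max M B le x = b -> main_max M B le y = b -> f x = f y -> x = y.
  move=> b; have bK : [set x | main_max M B le x = b] #<= [set: K].
    have [/small//|nBb] := pselect (B b).
    suff -> : [set x | main_max M B le x = b] = set0 by exact: card_ge0.
    by rewrite -subset0 => x /= xb; apply: nBb; rewrite -xb; exact: main_maxB.
  by have [f fL finj] := injective_transversal k bK LK; exists f.
exists (fun x => f (main_max M B le x) x); split=> [i|x]; last by have [] := fP (main_max M B le x).
apply: (main_max_inj_independent lf woB) => x y /= xi yi xy.
by have [_] := fP (main_max M B le x); apply=> //; rewrite xi xy yi.
Qed.

(** * From a coloring to a well-ordered base *)

Lemma support_exists B x : loop_free M -> base M B -> exists s : seq S,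
  [/\ [set` s] `<=` B, span M [set` s] x &
      ~ B x -> [set` s] = main_circle M B x `&` B].
Proof.
move=> lf bB; have [Bx|nBx] := pselect (B x).
  exists [:: x]; split=> //; first by move=> y /=; rewrite inE => /eqP->.
  by apply: subset_span; rewrite /= mem_head.
have [s [_ sE sx _]] := main_circle_support lf bB nBx.
by exists s; split=> //; rewrite sE => y [].
Qed.

(** The lexicographic order of the pairs [(h x, x)], in which points with the same [h] are
    consecutive. *)
Lemma lex_wo (lt : S -> S -> Prop) (h : S -> S) : strict_wo lt ->
  exists2 le : rel S, well_order le & forall x y, le x y -> lt (h x) (h y) \/ h x = h y.
Proof.
move=> [wf irr tr tot].
pose lth x y := lt (h x) (h y) \/ (h x = h y /\ lt x y).
exists (fun x y => `[< x = y \/ lth x y >]); last first.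
  by move=> x y /asboolP[->|[|[]]]; [right|left|right].
apply: antisymmetric_well_order => [x y /andP[/asboolP[//|xy] /asboolP[//|]]|A [a Aa]].
  move: xy => [xy|[xy xy']] [yx|[yx yx']].
  - by case: (irr (h x)); exact: tr yx.
  - by rewrite yx in xy; case: (irr _ xy).
  - by rewrite xy in yx; case: (irr _ yx).
  - by case: (irr x); exact: tr yx'.
have [|_ [z Az <-] zmin] := @wf_minimum _ _ [set h x | x in [set x | x \in A]] wf.
  by exists (h a), a.
have [|w [Aw wz] wmin] := @wf_minimum _ _ [set x | x \in A /\ h x = h z] wf.
  by exists z.
exists w; split=> // x Ax; apply/asboolP.
have [->|nwx] := pselect (w = x); [by left|right].
have nxz : ~ lt (h x) (h z) by apply: zmin; exists x.
have [e|ne] := pselect (h x = h z); last first.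
  by left; rewrite wz; have [] := tot _ _ ne.
right; split; first by rewrite wz.
by have [//|/wmin[]] := tot _ _ nwx.
Qed.

Lemma colorable_main_max (K : Type) : loop_free M -> infinite_set [set: K] ->
  colorable M K -> exists (B : set S) (le : rel S), well_ordered_base M B le /\
    forall b, B b -> [set x | main_max M B le x = b] #<= [set: K].
Proof.
move=> lf infK [Phi PhiP]; have [k _] := infinite_setN0 infK.
have /choice[B_ B_P] : forall i, exists B, base M B /\ Phi @^-1` [set i] `<=` B.
  by move=> i; have [B bB iB] := base_extend (PhiP i); exists B.
have bB i : base M (B_ i) by have [] := B_P i.
have BPhi x : B_ (Phi x) x by have [_] := B_P (Phi x); apply.
have /choice[supp suppP] : forall p : K * S, exists s : seq S,
    [/\ [set` s] `<=` B_ p.1, span M [set` s] p.2 &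
        ~ B_ p.1 p.2 -> [set` s] = main_circle M (B_ p.1) p.2 `&` B_ p.1].
  by move=> p; exact: support_exists.
have suppB i x : [set` supp (i, x)] `<=` B_ i by have [] := suppP (i, x).
have supp_span i x : span M [set` supp (i, x)] x by have [] := suppP (i, x).
(* A set closed under all supports is a flat: each of its elements is spanned by
   the part of the set lying in [B_ i], and every [x] lies in some [B_ i]. *)
have closedP (T : set S) i x :
    (forall j y, T y -> [set` supp (j, y)] `<=` T) -> [set` supp (i, x)] `<=` T -> T x.
  move=> Tcl xT; apply: contrapT => nTx.
  have [iB _] := bB (Phi x); apply: (independent_span iB (BPhi x)).
  apply: (@span_mono _ _ (T `&` B_ (Phi x))).
    by move=> y [Ty By]; split=> // yx; apply: nTx; rewrite -yx.
  apply: span_trans (supp_span i x) => y /xT Ty.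
  apply: span_mono (supp_span (Phi x) y) => z zy; split; first exact: Tcl zy.
  exact: suppB zy.
(* A pair [(i, n)] moves from [y] to entry [n] of its support in [B_ i]; past the end, the default
   value stays at [y]. Finite paths of such moves make up [hull x], which is therefore no larger
   than the set of sequences over [K]. *)
pose step y (p : K * nat) := nth y (supp (p.1, y)) p.2.
pose hull x := range (foldl step x).
have hull_refl x : hull x x by exists [::].
have hull_supp x i y z : hull x y -> z \in supp (i, y) -> hull x z.
  move=> [s _ <-] zs; exists (rcons s (i, index z (supp (i, foldl step x s)))) => //.
  by rewrite foldl_rcons /step /= nth_index.
have hull_card x : hull x #<= [set: K].
  apply: card_le_trans (card_image_le _ _) _; apply: card_le_trans (card_seq_le infK).
  have [p _ pinj] := card_le_funP k (card_square_le infK).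
  have /infiniteP/(card_le_funP k)[e _ einj] := infK.
  apply: (@card_le_fun _ _ _ _ (map (fun u => p (u.1, e u.2)))) => // s t _ _.
  apply: inj_map => -[i m] [j n] /= /pinj E.
  by have [-> /einj->] := E Logic.I Logic.I.
have [lt wo] := strict_wo_exists S; have [wf irr tr tot] := wo.
(* [h z] is the stage at which [z] enters when the hulls are added in the order [lt]: the least
   point whose hull contains [z]. *)
have /choice[h hP] : forall z, exists x, hull x z /\ forall y, hull y z -> ~ lt y x.
  move=> z; have [|x xz xmin] := @wf_minimum _ _ [set x | hull x z] wf.
    by exists z; exact: hull_refl.
  by exists x.
(* The hull of [h y] contains [y], hence its supports, so these enter no later than [y]. *)
have hsupp i y z : z \in supp (i, y) -> ~ lt (h y) (h z).
  by move=> zy; apply: (hP z).2; apply: hull_supp zy; have [] := hP y.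
have [le lewo leh] := lex_wo h wo.
(* Any of the bases would do; the color [k] is arbitrary. *)
have woB : well_ordered_base M (B_ k) le by split=> //; apply: withinW.
exists (B_ k), le; split=> // b Bb.
apply: card_le_trans (hull_card (h b)); apply: subset_card_le => z /= zb.
(* The fiber of [b] lies in one hull as soon as all its points enter at the same stage as [b]. *)
suff <- : h z = h b by have [] := hP z.
have [Bz|nBz] := pselect (B_ k z); first by rewrite -zb main_max_in.
have [Cb [_ bub]] := main_max_out lf woB nBz; rewrite zb in Cb bub.
have [_ _ /(_ nBz)/= sE] := suppP (k, z).
have bz : b \in supp (k, z).
  by have : (main_circle M (B_ k) z `&` B_ k) b by []; rewrite -sE.
apply: contrapT => nzb; have [zlt|] := tot _ _ nzb; last first.
  (* The points entering no later than [b] form a set closed under supports. It contains the support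
     of [z], because [le] respects stages and [b] is the [le]-greatest point of that support; so it
     contains [z]. *)
  suff : ~ lt (h b) (h z) by [].
  apply: (@closedP [set w | ~ lt (h b) (h w)] k).
    move=> j y /= by_ w wy bw; have := hsupp _ _ _ wy.
    have [e|nyw] := pselect (h y = h w); first by move=> _; apply: by_; rewrite e.
    by have [//|wy'] := tot _ _ nyw; move=> _; apply: by_; exact: tr wy'.
  rewrite sE => w [Cw Bw] /= bw; have [wb|wb] := leh _ _ (bub _ Cw Bw).
    by apply: (irr (h b)); exact: tr wb.
  by apply: (irr (h b)); rewrite -{2}wb.
(* Conversely, [b] is in the support of [z] and so enters no later than [z]. *)
exact: (hsupp _ _ _ bz).
Qed.

End Colorings.

Theorem theorem2 (S : choiceType) (M : finitary_matroid S) (K : Type)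
  (hM : loop_free M) (hK : infinite_set [set: K]) :
  (Chr_le M K <-> List_le M K) /\
  (List_le M K <->
     exists (B : set S) (le : rel S),
       well_ordered_base M B le /\
       forall b : S, B b -> [set x : S | main_max M B le x = b] #<= [set: K]).
Proof.
have base_list : (exists (B : set S) (le : rel S), well_ordered_base M B le /\
    forall b : S, B b -> [set x : S | main_max M B le x = b] #<= [set: K]) ->
    list_colorable M K.
  by move=> [B [le [woB small]]]; exact: main_max_list_colorable small.
rewrite Chr_leP List_leP; split; split=> //.
- by move=> /(colorable_main_max hM hK)/base_list.
- exact: list_colorable_colorable.
- by move=> /list_colorable_colorable/(colorable_main_max hM hK).
Qed.
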